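(* Let $\alpha\in(1,2)$ and $\varsigma_\alpha=|\cos(\frac{\alpha}{2}\pi)|$. Assume: (i) for any $x\in(x_L,x_R)$, $d(x)\in[\kappa_{\min},\kappa_{\max}]$ for positive constants $\kappa_{\min}$ and $\kappa_{\max}$; (ii) $\kappa_{\max}-\nu_\alpha>0$, where $\nu_\alpha=\sqrt2(\kappa_{\max}-\kappa_{\min})/\varsigma_\alpha$; (iii) $d$ is concave. Then, for any integers $N\ge1$ and $M\ge1$, $\Sigma^2(\mathbf{A}\mathbf{P}^{-1})\subset[\check s,\hat s]$, and thus $$\sup_{N,M\ge1}\mathrm{cond}(\mathbf{A}\mathbf{P}^{-1})\le\sqrt{\hat s/\check s},$$ where $\check s$ and $\hat s$ are the positive constants, independent of $\tau$ and $h$, given by $$\check s=\min\left\{\frac{\kappa_{\max}-\nu_\alpha}{\kappa_{\max}},\frac{\kappa_{\min}^2}{\kappa_{\max}^2}\right\},\qquad \hat s=\max\left\{\frac{\kappa_{\max}+\nu_\alpha}{\kappa_{\min}},\frac{\kappa_{\max}^2}{\kappa_{\min}^2}\right\}.$$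
   Context: Let $x_L<x_R$, $T>0$, $h=(x_R-x_L)/(M+1)$, $\tau=T/N$, $x_i=x_L+ih$. Define $g_0^{(\alpha)}=1$, $g_k^{(\alpha)}=\left(1-\frac{\alpha+1}{k}\right)g_{k-1}^{(\alpha)}$ for $k\ge1$, and $w_0^{(\alpha)}=\frac{\alpha}{2}g_0^{(\alpha)}$, $w_k^{(\alpha)}=\frac{\alpha}{2}g_k^{(\alpha)}+\frac{2-\alpha}{2}g_{k-1}^{(\alpha)}$ for $k\ge1$. $G_\alpha\in\mathbb{R}^{M\times M}$ is the Toeplitz matrix whose $(i,j)$ entry is $w_{i-j+1}^{(\alpha)}$ if $i-j+1\ge0$ and $0$ otherwise. $D=\mathrm{diag}(d(x_1),\dots,d(x_M))$ and $\bar d=\frac1M\sum_{i=1}^M d(x_i)$. With $\eta=\tau/(2h^\alpha)$ and $I_M$ the identity matrix, $\mathbf{A}=I_M-\eta DG_\alpha$ and $\mathbf{P}=I_M-\eta\bar d\,G_\alpha$ (the Toeplitz preconditioner). $\Sigma(\mathbf{C})$ is the set of singular values of $\mathbf{C}$, $\Sigma^2(\mathbf{C})=\{x^2: x\in\Sigma(\mathbf{C})\}$, and $\mathrm{cond}(\mathbf{C})=\|\mathbf{C}\|_2\|\mathbf{C}^{-1}\|_2$. *)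

(* Defs.v *)
From HB Require Import structures.
From mathcomp Require Import all_boot all_order all_algebra.
From mathcomp Require Import all_classical all_reals all_analysis.

Set Implicit Arguments.
Unset Strict Implicit.
Unset Printing Implicit Defensive.

Import Order.TTheory GRing.Theory Num.Theory.

Local Open Scope classical_set_scope.
Local Open Scope ring_scope.

Section Discretization.
Variable R : realType.
Implicit Types (alpha x : R) (d : R -> R) (M N : nat).

Fixpoint gcoef alpha (k : nat) : R :=
  if k is k'.+1 then (1 - (alpha + 1) / k'.+1%:R) * gcoef alpha k' else 1.

Definition wcoef alpha (k : nat) : R :=
  if k is k'.+1
  then alpha / 2 * gcoef alpha k'.+1 + (2 - alpha) / 2 * gcoef alpha k'
  else alpha / 2 * gcoef alpha 0.

(* Rows and columns are numbered from 0 here; the offset i - j + 1 is unaffected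
   by the shift, and the test guards the truncated subtraction. *)
Definition Gmx alpha M : 'M[R]_M :=
  \matrix_(i < M, j < M)
    if (j <= i.+1)%N then wcoef alpha (i.+1 - j)%N else 0.

Definition meshsize (xL xR : R) M : R := (xR - xL) / M.+1%:R.

Definition timestep (T : R) N : R := T / N%:R.

Definition gridpoint (xL xR : R) M (i : nat) : R :=
  xL + i%:R * meshsize xL xR M.

Definition eta (xL xR T alpha : R) N M : R :=
  timestep T N / (2 * meshsize xL xR M `^ alpha).

(* The ordinal i : 'I_M stands for the interior node x_(i+1). *)
Definition Dmx (xL xR : R) d M : 'M[R]_M :=
  diag_mx (\row_(i < M) d (gridpoint xL xR M i.+1)).

Definition dbar (xL xR : R) d M : R :=
  M%:R^-1 * \sum_(1 <= i < M.+1) d (gridpoint xL xR M i).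

Definition Amx (xL xR T alpha : R) d N M : 'M[R]_M :=
  1%:M - eta xL xR T alpha N M *: (Dmx xL xR d M *m Gmx alpha M).

Definition Pmx (xL xR T alpha : R) d N M : 'M[R]_M :=
  1%:M - (eta xL xR T alpha N M * dbar xL xR d M) *: Gmx alpha M.

End Discretization.

Section SingularValues.
Variables (R : realType) (n : nat).
Implicit Types (C : 'M[R]_n) (v : 'cV[R]_n).

Definition singular_values C : set R :=
  [set s | 0 <= s /\ eigenvalue (C^T *m C) (s ^+ 2)].

Definition sq_singular_values C : set R :=
  [set s ^+ 2 | s in singular_values C].

Definition norm2 v : R := Num.sqrt (\sum_(i < n) v i ord0 ^+ 2).

Definition mxnorm2 C : R :=
  sup [set norm2 (C *m v) | v in [set v | norm2 v <= 1]].

(* Meaningful only for C \in unitmx: invmx is the identity elsewhere. *)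
Definition cond2 C : R := mxnorm2 C * mxnorm2 (invmx C).

End SingularValues.

Definition concave_function (R : realType) (S : set R) (f : R -> R) : Prop :=
  @convex_function R R^o S (\- f).

Section Bounds.
Variable R : realType.
Implicit Types alpha kmin kmax : R.

Definition varsigma alpha : R := `|cos (alpha / 2 * pi)|.

Definition nu alpha kmin kmax : R :=
  Num.sqrt 2 * (kmax - kmin) / varsigma alpha.

Definition s_check alpha kmin kmax : R :=
  Num.min ((kmax - nu alpha kmin kmax) / kmax) (kmin ^+ 2 / kmax ^+ 2).

Definition s_hat alpha kmin kmax : R :=
  Num.max ((kmax + nu alpha kmin kmax) / kmin) (kmax ^+ 2 / kmin ^+ 2).

End Bounds.

(* Main.v *)
Require Import Defs.
From HB Require Import structures.
From mathcomp Require Import all_boot all_order all_algebra.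
From mathcomp Require Import all_classical all_reals all_analysis.
From mathcomp Require Import ring lra zify.

Set Implicit Arguments.
Unset Strict Implicit.
Unset Printing Implicit Defensive.

Import Order.TTheory GRing.Theory Num.Theory.
Import numFieldNormedType.Exports.

Local Open Scope classical_set_scope.
Local Open Scope ring_scope.

(** Write a = alpha / 2, vs = |cos (a pi)|, G for the Toeplitz matrix, D for the
    diagonal of the values of d, H for - (G + G^T) / 2, and
    E = kmax I - D, a diagonal matrix with entries in [0, kmax - kmin].

    Singular values of A P^-1 are controlled by comparing |A y|^2 with |P y|^2
    for every vector y.  Expanding both,
      |A y|^2 = |y|^2 - 2 eta <y, D G y> + eta^2 |D G y|^2,
      |P y|^2 = |y|^2 + 2 eta dbar <y, H y> + eta^2 dbar^2 |G y|^2,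
    the terms in eta^0 and eta^2 compare at once, since d and dbar both lie in
    [kmin, kmax].  In the term in eta, - <y, D G y> = kmax <y, H y> + <E y, G y>,
    so everything rests on
      |<E y, G y>| <= nu <y, H y>,    nu = sqrt 2 (kmax - kmin) / vs
    (lemma convex_multiplier_form).  It has two ingredients.

    The first one (sector_Gmx) says that the numerical range of G lies in a
    sector around the negative real axis:
      2 vs <u, G v> <= <u, H u> + <v, H v>.
    The symbol of G at the angle t is g(t) = (1 - a + a e^{-it}) F(t), where
    F(t) = sum_k g_k e^{ikt} is the boundary value of (1 - z)^alpha, so that
    F(t) = (2 sin (t/2))^alpha e^{ia(t - pi)}; elementary trigonometry then gives
    vs |g| <= - Re g.  The expression of F is obtained without infinite series.
    The partial sum F_n, turned by e^{-ia(t - pi)}, satisfies exactly the real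
    linear equation 2 sin (t/2) R' = alpha cos (t/2) R + error
    (symbol_sum_ode), because the recurrence of the g_k makes the sum telescope;
    the error is at most eps_n = (n + 1) g_{n+1}, which is O(1/n) as
    alpha > 1.  Comparison on ]0, pi] gives the argument of F_n up to eps_n,
    uniformly in t.  Averaging over equidistant angles recovers the quadratic
    forms of G exactly, and n tends to infinity.

    The second one (dirichlet_multiplier, symG_convex_row) is
      <E y, H E y> <= 2 (kmax - kmin)^2 <y, H y>.
    The off-diagonal entries of H are nonpositive and its row sums are
    nonnegative, so H is a discrete Dirichlet form.  Concavity of d makes the
    entries of E convex: pairing the neighbours at equal distance on both sides
    of a node shows that (H e)_i <= 2 e_i (H 1)_i in each row i, where e is the
    diagonal of E; the factor 2 is the price of the neighbours that fall outside
    the grid.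

    The first inequality for u = E y / (sqrt 2 (kmax - kmin)) and v = y or - y,
    followed by the second one, gives the bound on <E y, G y>. *)

(** * Signs and sums of the coefficients *)

Section Coefficients.
Variable R : realType.
Implicit Types alpha x : R.

Lemma gcoefS alpha k :
  k.+1%:R * gcoef alpha k.+1 = (k%:R - alpha) * gcoef alpha k.
Proof.
rewrite /= mulrA mulrBr mulr1 mulrCA divff ?pnatr_eq0// mulr1.
by rewrite -natr1; congr (_ * _); ring.
Qed.

(** Up to the factor - 1 / alpha this is the partial sum of the g_k up to n; it is
    also the truncation error in the differential equation for the partial sums
    of the symbol. *)
Definition tail_weight alpha n : R := n.+1%:R * gcoef alpha n.+1.

Lemma gcoef_ge0 alpha k : 1 <= alpha <= 2 -> (2 <= k)%N -> 0 <= gcoef alpha k.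
Proof.
move=> /andP[a1 a2]; elim: k => // k IH; case: (ltngtP k 1) => [|k1 _|-> _]; first by case: k {IH}.
  rewrite -(pmulr_rge0 _ (ltr0Sn R k)) gcoefS.
  rewrite mulr_ge0 ?IH// subr_ge0 (le_trans a2)// ler_nat//.
have -> : gcoef alpha 2 = alpha * (alpha - 1) / 2 by rewrite /=; field.
by rewrite divr_ge0// mulr_ge0; lra.
Qed.

Lemma tail_weight_ge0 alpha n :
  1 <= alpha <= 2 -> (1 <= n)%N -> 0 <= tail_weight alpha n.
Proof. by move=> a12 n1; rewrite mulr_ge0// gcoef_ge0. Qed.

Lemma sum_gcoef alpha n :
  alpha * \sum_(k < n.+1) gcoef alpha k = - tail_weight alpha n.
Proof.
rewrite /tail_weight; elim: n => [|n IH].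
  by rewrite big_ord1 gcoefS /=; ring.
by rewrite big_ord_recr/= mulrDr IH -!/(gcoef _ _.+1) [in RHS]gcoefS; ring.
Qed.

Lemma sum_gcoef_le0 alpha n :
  1 <= alpha <= 2 -> (1 <= n)%N -> \sum_(k < n.+1) gcoef alpha k <= 0.
Proof.
move=> a12 n1; have a0 : 0 < alpha by lra.
by rewrite -(pmulr_rle0 _ a0) sum_gcoef oppr_le0 tail_weight_ge0.
Qed.

(** The partial sum of the symbol at t = pi, which is real and fixes its direction
    there.  The terms 1 and alpha dominate since the remaining g_k, all
    nonnegative, sum to at most alpha - 1. *)
Lemma alternating_gcoef_ge0 alpha n : 1 <= alpha <= 2 ->
  0 <= \sum_(k < n.+1) (-1) ^+ k * gcoef alpha k.
Proof.
move=> a12; case: n => [|n]; first by rewrite big_ord1 /= mulr1 ler01.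
have := sum_gcoef_le0 a12 (ltn0Sn n).
rewrite !big_ord_recl/= /bump/= !divr1 expr1 !mulr1 => le0.
suff : - \sum_(i < n) gcoef alpha i.+2 <=
       \sum_(i < n) (-1) ^+ i.+2 * gcoef alpha i.+2.
  by move: le0; rewrite -!/(gcoef _ _.+1)/=; lra.
rewrite -sumrN; apply: ler_sum => i _.
have := @gcoef_ge0 alpha i.+2 a12 isT; move: (gcoef _ _) => x x0.
by rewrite -signr_odd; case: odd; rewrite ?expr0 ?expr1; lra.
Qed.

(** The weights e_n = n g_n satisfy e_{n+1} = (1 - alpha / n) e_n, and 1 - alpha / n
    is at most (n - 1) / n, so (n - 1) e_n does not increase. *)
Lemma tail_weight_le alpha n : 1 <= alpha <= 2 ->
  n.+1%:R * tail_weight alpha n.+1 <= 2.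
Proof.
move=> a12; elim: n => [|n IH].
  by rewrite /tail_weight gcoefS /= -/(1%:R) divr1; nra.
apply: le_trans IH; rewrite {1}/tail_weight gcoefS /tail_weight.
have := @gcoef_ge0 alpha n.+2 a12 isT; move: (gcoef alpha n.+2) => g g0.
rewrite [n.+1%:R * _]mulrCA ler_wpM2l// ler_wpM2r// -[n.+2%:R]natr1.
by move: a12 => /andP[]; lra.
Qed.

Lemma tail_weight_small alpha e : 1 <= alpha <= 2 -> 0 < e ->
  exists N, forall n, (N <= n)%N -> tail_weight alpha n <= e.
Proof.
move=> a12 e0; exists (Num.truncn (2 / e)).+2 => -[//|n] nN.
have := tail_weight_le n a12; rewrite mulrC -ler_pdivlMr// => /le_trans; apply.
rewrite ler_pdivrMr// -ler_pdivrMl// mulrC.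
apply: ltW; apply: lt_le_trans (truncnS_gt _) _.
by rewrite ler_nat; exact: ltnW.
Qed.

Lemma wcoef0D2_ge0 alpha : 1 <= alpha <= 2 -> 0 <= wcoef alpha 0 + wcoef alpha 2.
Proof.
move=> a12; have -> : wcoef alpha 0 + wcoef alpha 2 = alpha * (alpha - 1) * (alpha + 2) / 4.
  by rewrite /=; field.
by rewrite divr_ge0// !mulr_ge0//; lra.
Qed.

Lemma wcoef_ge0 alpha k : 1 <= alpha <= 2 -> (3 <= k)%N -> 0 <= wcoef alpha k.
Proof.
move=> a12; case: k => // k k3.
by apply: addr_ge0; apply: mulr_ge0; rewrite ?gcoef_ge0 ?(ltnW k3)//; lra.
Qed.

Lemma sum_wcoef_le0 alpha n : 1 <= alpha <= 2 ->
  \sum_(k < n.+3) wcoef alpha k <= 0.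
Proof.
move=> a12; have -> : \sum_(k < n.+3) wcoef alpha k =
    alpha / 2 * (\sum_(k < n.+3) gcoef alpha k) +
    (2 - alpha) / 2 * (\sum_(k < n.+2) gcoef alpha k).
  rewrite big_ord_recl [X in alpha / 2 * X]big_ord_recl mulrDr -addrA.
  by congr (_ + _); rewrite !mulr_sumr -big_split.
have := @sum_gcoef_le0 alpha n.+2 a12 isT.
have := @sum_gcoef_le0 alpha n.+1 a12 isT.
move: (\sum_(i < n.+2) _) (\sum_(i < n.+3) _) => x y x0 y0.
nra.
Qed.

End Coefficients.

(** * Argument of the truncated binomial symbol on the unit circle *)

Section SymbolSum.
Variable R : realType.
Implicit Types (alpha c t : R) (n : nat).

(** The imaginary part of e^{i(c - at)} F_n(t).  For c = a pi and
    c = a pi + pi / 2 these are the imaginary and real parts of F_n turned by the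
    expected argument, e^{-ia(t - pi)}. *)
Definition symbol_sum alpha n c t : R :=
  \sum_(k < n.+1) gcoef alpha k * sin ((k%:R - alpha / 2) * t + c).

Definition symbol_sum_deriv alpha n c t : R :=
  \sum_(k < n.+1)
     gcoef alpha k * ((k%:R - alpha / 2) * cos ((k%:R - alpha / 2) * t + c)).

Lemma is_derive_symbol_sum alpha n c t :
  is_derive t 1 (symbol_sum alpha n c) (symbol_sum_deriv alpha n c t).
Proof.
rewrite (_ : symbol_sum alpha n c = \sum_(k < n.+1)
  (fun t => gcoef alpha k * sin ((k%:R - alpha / 2) * t + c))); last first.
  by apply/funext => x; rewrite fct_sumE.
apply: is_derive_sum => k.
pose f t := (k%:R - alpha / 2) * t + c.
have df : is_derive t 1 f (k%:R - alpha / 2).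
  rewrite /f; apply: is_derive_eq.
  by rewrite addr0 [_ *: 1]mulr1.
have dsf := is_derive1_comp (is_derive_sin (f t)) df.
have := @is_deriveZ _ _ _ (sin \o f) (gcoef alpha k) t 1 _ dsf.
by rewrite mulrC.
Qed.

(** With s_k = sin ((k - a) t + c - t / 2), the k-th term of the left-hand side is
    (k - alpha) g_k s_{k+1} - k g_k s_k, and (k - alpha) g_k = (k + 1) g_{k+1}: the
    sum telescopes. *)
Lemma symbol_sum_ode alpha n c t :
  2 * sin (t / 2) * symbol_sum_deriv alpha n c t
  - alpha * cos (t / 2) * symbol_sum alpha n c t
  = tail_weight alpha n * sin ((n.+1%:R - alpha / 2) * t + c - t / 2).
Proof.
have step k g : 2 * sin (t / 2) *
     (g * ((k%:R - alpha / 2) * cos ((k%:R - alpha / 2) * t + c)))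
   - alpha * cos (t / 2) * (g * sin ((k%:R - alpha / 2) * t + c))
   = (k%:R - alpha) * g * sin ((k.+1%:R - alpha / 2) * t + c - t / 2)
     - k%:R * g * sin ((k%:R - alpha / 2) * t + c - t / 2).
  have -> : (k.+1%:R - alpha / 2) * t + c - t / 2 =
            (k%:R - alpha / 2) * t + c + t / 2.
    by rewrite -natr1; field.
  by move: (_ * t + c) => psi; rewrite sinD sinB; field.
rewrite /symbol_sum /symbol_sum_deriv /tail_weight.
elim: n => [|n IH].
  by rewrite !big_ord1 step gcoefS mul0r mul0r subr0.
rewrite !(big_ord_recr n.+1)/= !mulrDr opprD addrACA IH step.
by rewrite [X in _ = X * _]gcoefS -!/(gcoef _ _.+1); ring.
Qed.

(** The homogeneous equation is solved by sin (t/2)^alpha.  Dividing by it, the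
    derivative of the error term is dominated by that of
    - eps cos (t/2) sin (t/2)^-alpha, which vanishes at pi; this uses
    1 <= alpha.  Hence Z below is nonincreasing, and Z pi >= 0. *)
Lemma symbol_sum_ge_gt0 alpha n c t : 1 <= alpha <= 2 -> (1 <= n)%N ->
  0 < t <= pi -> 0 <= symbol_sum alpha n c pi ->
  - tail_weight alpha n <= symbol_sum alpha n c t.
Proof.
move=> a12 n1 tpi Rpi.
have e0 := tail_weight_ge0 a12 n1; set e := tail_weight alpha n in e0 *.
have half (x : R) : 0 < x <= pi -> 0 < sin (x / 2).
  by move=> xpi; apply: sin_gt0_pi; have := @pi_gt0 R; lra.
pose u x := sin (x / 2) : R.
pose v x := symbol_sum alpha n c x + e * cos (x / 2).
pose Z x := u x `^ (- alpha) * v x.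
have dh (x : R) : is_derive x (1 : R) (fun y : R => y / 2) (1 / 2).
  rewrite (_ : (fun y : R => y / 2) = (1 / 2) \*: id); last first.
    by apply/funext => y; rewrite /= /GRing.scale/=; field.
  by apply: is_derive_eq; rewrite [_ *: _]mulr1.
have du (x : R) : is_derive x (1 : R) u (cos (x / 2) * (1 / 2)).
  exact: (is_derive1_comp (is_derive_sin _) (dh x)).
have dv (x : R) : is_derive x (1 : R) v (symbol_sum_deriv alpha n c x + e * (- sin (x / 2) * (1 / 2))).
  have dc := @is_derive1_comp _ _ (fun y : R => y / 2) _ _ _ (is_derive_cos _) (dh x).
  exact: (is_deriveD (is_derive_symbol_sum _ _ _ _)
                     (@is_deriveZ _ _ _ _ e x 1 _ dc)).
have dZ (x : R) : 0 < x <= pi -> is_derive x (1 : R) Z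
   (u x `^ (- alpha) * (symbol_sum_deriv alpha n c x + e * (- sin (x / 2) * (1 / 2)))
    + v x * (- alpha * u x `^ (- alpha - 1) * (cos (x / 2) * (1 / 2)))).
  move=> xpi.
  have dp := @is_derive1_comp _ (fun y : R => y `^ (- alpha)) u _ _ _
    (is_derive1_powR (- alpha) (half _ xpi)) (du x).
  exact: (is_deriveM dp (dv x)).
have Zpi : Z pi = symbol_sum alpha n c pi.
  by rewrite /Z /u /v sin_pihalf cos_pihalf powR1 mul1r mulr0 addr0.
have Zt : Z pi <= Z t.
  apply: (@ler0_derive1_le_cc R Z t pi) => //.
  - move=> x; rewrite in_itv/= => xpi; have : 0 < x <= pi by lra.
    by move=> /dZ [].
  - move=> x; rewrite in_itv/= => xpi; have x0pi : 0 < x <= pi by lra.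
    rewrite derive1E (@derive_val _ _ _ _ _ _ _ (dZ x x0pi)).
    have ux := half _ x0pi; rewrite -/(u x) in ux *.
    have -> : u x `^ (- alpha) = u x `^ (- alpha - 1) * u x.
      rewrite -[X in _ * X]powRr1 ?ltW// -powRD ?subrK//.
      by apply/implyP => _; rewrite gt_eqF.
    set p := _ `^ _; have p0 : 0 <= p by exact: powR_ge0.
    have := symbol_sum_ode alpha n c x; rewrite -/(u x) /v -/e.
    set s := sin (_ - _); have s1 : s <= 1 by exact: sin_le1.
    have := cos2Dsin2 (x / 2); rewrite -/(u x).
    move: (symbol_sum_deriv _ _ _ _) (symbol_sum _ _ _ _) (cos _) => D S C CU ode.
    have -> : p * u x * (D + e * (- u x * (1 / 2)))
        + (S + e * C) * (- alpha * p * (C * (1 / 2)))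
        = p / 2 * ((2 * u x * D - alpha * C * S)
                   - e * (u x ^+ 2 + alpha * C ^+ 2)) by field.
    rewrite ode mulr_ge0_le0 ?divr_ge0// -mulrBr mulr_ge0_le0//.
    by move: (sqr_ge0 C); nra.
  - apply: derivable_within_continuous => x; rewrite in_itv/= => xpi.
    by have /dZ [] : 0 < x <= pi by lra.
  - by rewrite in_itv/= lexx; lra.
  - by rewrite in_itv/= lexx; lra.
  - lra.
have : 0 <= Z t by rewrite (le_trans _ Zt)// Zpi.
have st := half _ tpi.
rewrite /Z pmulr_rge0 ?powR_gt0// /v => ge0.
have := cos_le1 (t / 2); nra.
Qed.

(** At t = 0 the equation degenerates, but the partial sum of the g_k is known in
    closed form. *)
Lemma symbol_sum_ge alpha n c t : 1 <= alpha <= 2 -> (1 <= n)%N ->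
  0 <= t <= pi -> 0 <= symbol_sum alpha n c pi ->
  - tail_weight alpha n <= symbol_sum alpha n c t.
Proof.
move=> a12 n1 tpi Rpi; have [t0|t0] := eqVneq t 0; last first.
  by apply: symbol_sum_ge_gt0 => //; lra.
have -> : symbol_sum alpha n c t = sin c * \sum_(k < n.+1) gcoef alpha k.
  rewrite mulr_sumr; apply: eq_bigr => k _.
  by rewrite t0 mulr0 add0r mulrC.
have := sum_gcoef alpha n; have := tail_weight_ge0 a12 n1.
move: (tail_weight _ _) (\sum_(_ < _) _) (sin_max c) => e s.
rewrite ler_norml => sc; nra.
Qed.

End SymbolSum.

(** * The symbol lies in a sector *)

Section Sector.
Variable R : realType.
Implicit Types (alpha a t : R).

(** That sin x / x decreases on [0, pi], compared at a t and (1 - a) t; proved by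
    differentiating the difference in t. *)
Lemma sin_ratio_le a t : 1 / 2 <= a <= 1 -> 0 <= t <= pi ->
  (1 - a) * sin (a * t) <= a * sin ((1 - a) * t).
Proof.
move=> a12 tpi.
pose h t := a * sin ((1 - a) * t) - (1 - a) * sin (a * t) : R.
have dsin (b x : R) : is_derive x (1 : R) (fun y : R => sin (b * y)) (cos (b * x) * b).
  have dm : is_derive x (1 : R) (fun y : R => b * y) b.
    by rewrite -[X in is_derive _ _ _ X]mulr1; exact: (@is_deriveZ _ _ _ id b x 1).
  exact: (@is_derive1_comp _ _ (fun y : R => b * y) _ _ _ (is_derive_sin _) dm).
have dh (x : R) : is_derive x (1 : R) h
    (a * (cos ((1 - a) * x) * (1 - a)) - (1 - a) * (cos (a * x) * a)).
  exact: (is_deriveB (@is_deriveZ _ _ _ _ a x 1 _ (dsin _ x))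
                     (@is_deriveZ _ _ _ _ (1 - a) x 1 _ (dsin _ x))).
have : h 0 <= h t; last by rewrite /h !mulr0 !sin0; lra.
apply: (@ger0_derive1_le_cc R h 0 pi) => //.
- move=> x; rewrite in_itv/= => xpi.
  rewrite derive1E (@derive_val _ _ _ _ _ _ _ (dh x)).
  have -> : a * (cos ((1 - a) * x) * (1 - a)) - (1 - a) * (cos (a * x) * a)
     = a * (1 - a) * (cos ((1 - a) * x) - cos (a * x)) by ring.
  rewrite mulr_ge0 ?mulr_ge0 ?subr_ge0//; try lra.
  have [xa|xa] := eqVneq ((1 - a) * x) (a * x); first by rewrite xa.
  have lta : (1 - a) * x < a * x by rewrite lt_neqAle xa/=; nra.
  by rewrite ltW// ltr_cos// in_itv/=; nra.
- by apply: derivable_within_continuous => x _; have [] := dh x.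
- by rewrite in_itv/= lexx pi_ge0.
- by case/andP: tpi.
Qed.

(** With g = gc + i gs, U = Uc + i Us and V = Vc + i Vs, this is
    - Re g (|U|^2 + |V|^2) - 2 vs Re (g V conj U), the density of the sector inequality
    at one angle.  It is linear in g, which is what allows g to be perturbed. *)
Definition sector_form (vs gc gs Uc Us Vc Vs : R) : R :=
  - gc * (Uc ^+ 2 + Us ^+ 2) - gc * (Vc ^+ 2 + Vs ^+ 2)
  - 2 * vs * (gc * (Vc * Uc + Vs * Us) - gs * (Vs * Uc - Vc * Us)).

(** Multiplied by - Re g, the form is at least |(Re g) U + vs g V|^2, because
    vs |g| <= - Re g. *)
Lemma sector_form_ge0 vs gc gs Uc Us Vc Vs : 0 < vs -> gc <= 0 ->
  vs ^+ 2 * (gc ^+ 2 + gs ^+ 2) <= gc ^+ 2 ->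
  0 <= sector_form vs gc gs Uc Us Vc Vs.
Proof.
move=> vs0 gc0 vsg; have [g0|g0] := eqVneq gc 0.
  suff -> : gs = 0 by rewrite /sector_form g0; lra.
  apply/eqP; rewrite -sqrf_eq0 eq_le sqr_ge0 andbT.
  rewrite -(pmulr_rle0 _ (exprn_gt0 2 vs0)).
  by move: vsg; rewrite g0 expr0n add0r.
have {}g0 : 0 < - gc by rewrite oppr_gt0 lt_neqAle g0.
rewrite -(pmulr_rge0 _ g0) /sector_form.
have := sqr_ge0 (gc * Uc + vs * (gc * Vc - gs * Vs)).
have := sqr_ge0 (gc * Us + vs * (gc * Vs + gs * Vc)).
have := sqr_ge0 Vc; have := sqr_ge0 Vs; nra.
Qed.

Lemma sector_form_norm_le vs gc gs Uc Us Vc Vs :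
  0 <= vs <= 1 -> `|gc| <= 1 -> `|gs| <= 1 ->
  `|sector_form vs gc gs Uc Us Vc Vs| <=
    3 * (Uc ^+ 2 + Us ^+ 2 + Vc ^+ 2 + Vs ^+ 2).
Proof.
move=> vs01 gc1 gs1; rewrite /sector_form.
set N := (_ + _ + _ + _).
have xN : `|Vc * Uc + Vs * Us| <= N / 2.
  rewrite ler_norml /N; have := sqr_ge0 (Vc - Uc); have := sqr_ge0 (Vc + Uc).
  by have := sqr_ge0 (Vs - Us); have := sqr_ge0 (Vs + Us); nra.
have yN : `|Vs * Uc - Vc * Us| <= N / 2.
  rewrite ler_norml /N; have := sqr_ge0 (Vs - Uc); have := sqr_ge0 (Vs + Uc).
  by have := sqr_ge0 (Vc - Us); have := sqr_ge0 (Vc + Us); nra.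
have N0 : 0 <= N by rewrite !addr_ge0// sqr_ge0.
have bnd (g x y : R) : `|g| <= 1 -> `|x| <= y -> `|g * x| <= y.
  by move=> g1 xy; rewrite normrM -[y]mul1r ler_pM.
have vs1 : `|vs| <= 1 by rewrite ger0_norm; lra.
have h1 := bnd _ _ _ vs1 (bnd _ _ _ gc1 xN).
have h2 := bnd _ _ _ vs1 (bnd _ _ _ gs1 yN).
have h3 : `|gc * N| <= N by apply: bnd => //; rewrite ger0_norm.
move: h1 h2 h3; rewrite !ler_norml.
have -> : - gc * (Uc ^+ 2 + Us ^+ 2) - gc * (Vc ^+ 2 + Vs ^+ 2) = - (gc * N).
  by rewrite /N; ring.
nra.
Qed.

Section Direction.
Variables (a t : R).
Hypotheses (a12 : 1 / 2 < a < 1) (tpi : 0 <= t <= pi).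

(** Real and imaginary parts of (1 - a + a e^{-it}) e^{ia(t - pi)}, a positive
    multiple of which is the symbol of G. *)
Definition dir_cos : R := a * cos (a * (t - pi) - t) + (1 - a) * cos (a * (t - pi)).
Definition dir_sin : R := a * sin (a * (t - pi) - t) + (1 - a) * sin (a * (t - pi)).

Lemma convex_norm_le1 (x y : R) :
  `|x| <= 1 -> `|y| <= 1 -> `|a * x + (1 - a) * y| <= 1.
Proof.
rewrite !ler_norml => /andP[x1 x2] /andP[y1 y2].
by have [a0 a1] := andP a12; apply/andP; split; nra.
Qed.

Lemma dir_cos_norm : `|dir_cos| <= 1.
Proof. by apply: convex_norm_le1; exact: cos_max. Qed.

Lemma dir_sin_norm : `|dir_sin| <= 1.
Proof. by apply: convex_norm_le1; exact: sin_max. Qed.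

(** Both angles a (t - pi) and a (t - pi) - t lie in [- pi, 0]. *)
Lemma dir_sin_le0 : dir_sin <= 0.
Proof.
have sin_le0 (x : R) : - pi <= x <= 0 -> sin x <= 0.
  by move=> xpi; rewrite -oppr_ge0 -sinN sin_ge0_pi//; lra.
have [a0 a1] := andP a12; have [t0 t1] := andP tpi; have p0 := @pi_gt0 R.
have h1 : sin (a * (t - pi)) <= 0 by apply: sin_le0; apply/andP; split; nra.
have h2 : sin (a * (t - pi) - t) <= 0 by apply: sin_le0; apply/andP; split; nra.
by rewrite /dir_sin; nra.
Qed.

(** The left-hand side is the imaginary part of the direction turned by a pi, namely
    (1 - a) sin (a t) - a sin ((1 - a) t). *)
Lemma dir_sector : sin (a * pi) * dir_cos + cos (a * pi) * dir_sin <= 0.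
Proof.
have a12' : 1 / 2 <= a <= 1 by have [a0 a1] := andP a12; rewrite !ltW.
have := sin_ratio_le a12' tpi.
have -> : sin (a * t) = sin (a * pi + a * (t - pi)) by congr sin; ring.
have -> : sin ((1 - a) * t) = - sin (a * pi + (a * (t - pi) - t)).
  by rewrite -sinN; congr sin; ring.
by rewrite /dir_sin /dir_cos !sinD; lra.
Qed.

Lemma cos_api_lt0 : cos (a * pi) < 0.
Proof.
have [a0 a1] := andP a12; have p0 := @pi_gt0 R.
by rewrite -cos_pihalf ltr_cos ?in_itv/=; nra.
Qed.

(** Since the direction is in the lower half-plane, one side of the sector suffices:
    sin (a pi) |Re| >= vs |Im|, which is vs |g| <= - Re g. *)
Lemma dir_sector_form_ge0 Uc Us Vc Vs :
  0 <= sector_form `|cos (a * pi)| dir_cos dir_sin Uc Us Vc Vs.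
Proof.
have c0 := cos_api_lt0.
rewrite ltr0_norm//.
have s0 : 0 < sin (a * pi).
  have [a0 a1] := andP a12; have p0 := @pi_gt0 R.
  by apply: sin_gt0_pi; apply/andP; split; nra.
have := dir_sector; have := dir_sin_le0; have := cos2Dsin2 (a * pi).
move: dir_cos dir_sin (sin _) (cos _) s0 c0 => C S s c s0 c0 cs S0 sec.
have C0 : C <= 0 by nra.
apply: sector_form_ge0 => //; first lra.
have : (- c * - S) ^+ 2 <= (s * - C) ^+ 2.
  by rewrite ler_sqr ?nnegrE ?mulr_ge0//; nra.
by nra.
Qed.

End Direction.

Definition symbol_cos alpha n t : R := \sum_(k < n.+1) gcoef alpha k *
  (alpha / 2 * cos ((k%:R - 1) * t) + (1 - alpha / 2) * cos (k%:R * t)).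
Definition symbol_sin alpha n t : R := \sum_(k < n.+1) gcoef alpha k *
  (alpha / 2 * sin ((k%:R - 1) * t) + (1 - alpha / 2) * sin (k%:R * t)).

(** The identity g = (1 - a + a e^{-it}) F_n, with F_n = (p + i q) e^{ia(t - pi)}. *)
Lemma symbol_polar alpha n t (a := alpha / 2)
    (q := symbol_sum alpha n (a * pi) t)
    (p := symbol_sum alpha n (a * pi + pi / 2) t) :
  symbol_cos alpha n t = p * dir_cos a t - q * dir_sin a t /\
  symbol_sin alpha n t = p * dir_sin a t + q * dir_cos a t.
Proof.
rewrite /symbol_cos /symbol_sin /p /q /symbol_sum !mulr_suml -sumrB -big_split/=.
split; apply: eq_bigr => k _; rewrite addrA sinDpihalf -/a;
  (have -> : (k%:R - 1) * t = ((k%:R - a) * t + a * pi) + (a * (t - pi) - t) by ring);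
  (have -> : k%:R * t = ((k%:R - a) * t + a * pi) + a * (t - pi) by ring);
  rewrite /dir_cos /dir_sin; move: (a * (t - pi)) (a * (t - pi) - t) (_ + a * pi) => z y x;
  rewrite ?cosD ?sinD; ring.
Qed.

Lemma symbol_sum_pi alpha n c : 1 <= alpha <= 2 ->
  symbol_sum alpha n c pi =
  sin (c - alpha / 2 * pi) * \sum_(k < n.+1) (-1) ^+ k * gcoef alpha k.
Proof.
move=> a12; rewrite mulr_sumr; apply: eq_bigr => k _.
have -> : (k%:R - alpha / 2) * pi + c = (c - alpha / 2 * pi) + pi *+ k.
  by rewrite -mulr_natl; ring.
by rewrite (alternatingn (@sinDpi R)); ring.
Qed.

(** The ideal symbol has q = 0 and p >= 0; here both may miss this by eps_n, and
    each unit of error costs at most 3 N by linearity of the form. *)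
Lemma symbol_sector_form_ge alpha n t Uc Us Vc Vs :
  1 < alpha < 2 -> (1 <= n)%N -> 0 <= t <= pi ->
  - (6 * tail_weight alpha n * (Uc ^+ 2 + Us ^+ 2 + Vc ^+ 2 + Vs ^+ 2)) <=
  sector_form `|cos (alpha / 2 * pi)| (symbol_cos alpha n t) (symbol_sin alpha n t)
    Uc Us Vc Vs.
Proof.
move=> a12 n1 tpi; have a12' : 1 <= alpha <= 2 by lra.
set a := alpha / 2; have ah : 1 / 2 < a < 1 by rewrite /a; lra.
have [-> ->] := symbol_polar alpha n t; rewrite -/a.
have alt := alternating_gcoef_ge0 n a12'.
have e0 := tail_weight_ge0 a12' n1.
have p_ge : - tail_weight alpha n <= symbol_sum alpha n (a * pi + pi / 2) t.
  apply: symbol_sum_ge => //; rewrite symbol_sum_pi// -/a addrAC subrr add0r.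
  by rewrite sin_pihalf mul1r.
have q_ge : - tail_weight alpha n <= symbol_sum alpha n (a * pi) t.
  by apply: symbol_sum_ge => //; rewrite symbol_sum_pi// -/a subrr sin0 mul0r.
have q_le : symbol_sum alpha n (a * pi) t <= tail_weight alpha n.
  rewrite -lerN2 (le_trans (@symbol_sum_ge _ alpha n (a * pi + pi) t _ _ _ _))//.
    by rewrite symbol_sum_pi// -/a addrAC subrr add0r sinpi mul0r.
  rewrite /symbol_sum -sumrN; apply: ler_sum => k _.
  by rewrite addrA sinDpi mulrN.
have B1 := dir_sector_form_ge0 ah tpi Uc Us Vc Vs.
have vs1 : 0 <= `|cos (a * pi)| <= 1 by rewrite normr_ge0 cos_max.
have := sector_form_norm_le Uc Us Vc Vs vs1 (dir_cos_norm t ah) (dir_sin_norm t ah).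
have Sn : `|- dir_sin a t| <= 1 by rewrite normrN dir_sin_norm.
have := sector_form_norm_le Uc Us Vc Vs vs1 Sn (dir_cos_norm t ah).
move: (`|cos _|) (dir_cos a t) (dir_sin a t) B1 {Sn vs1} => vs C S B1.
move: (symbol_sum _ _ _ _) (symbol_sum _ _ _ _) (tail_weight _ _) p_ge q_ge q_le e0.
move=> q p e p_ge q_ge q_le e0.
have -> : sector_form vs (p * C - q * S) (p * S + q * C) Uc Us Vc Vs
  = p * sector_form vs C S Uc Us Vc Vs + q * sector_form vs (- S) C Uc Us Vc Vs.
  by rewrite /sector_form; ring.
move: (sector_form vs C S _ _ _ _) (sector_form vs (- S) C _ _ _ _) B1 => x y x0.
move: (_ + _ + _ + _) => N; rewrite !ler_norml => /andP[y1 y2] /andP[_ x2].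
have : - e * (3 * N) <= p * x by nra.
have : - e * (3 * N) <= q * y by nra.
by nra.
Qed.

End Sector.

(** * From the symbol to the Toeplitz matrix *)

Section Averaging.
Variable R : realType.
Implicit Types (alpha t : R) (n M Q : nat).

(** Centred at 0, so that conjugation reduces every node to an angle in [0, pi]. *)
Definition node Q (l : nat) : R := 2 * pi * l%:R / Q%:R - pi.

Lemma node_itv Q l : (l < Q)%N -> - pi <= node Q l <= pi.
Proof.
move=> lQ; have Q0 : 0 < Q%:R :> R by rewrite ltr0n; case: Q lQ.
have p0 := @pi_gt0 R.
rewrite /node -mulrA lerBrDl subrr mulr_ge0 ?divr_ge0 ?ler0n//=; last lra.
have : l%:R / Q%:R <= 1 :> R by rewrite ler_pdivrMr// mul1r ler_nat ltnW.
by move: (_ / _) => x x1; nra.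
Qed.

(** Multiplied by sin (pi m / Q), the sum telescopes to a difference of sines whose
    arguments differ by 2 pi m. *)
Lemma sum_cos_node Q m : (0 < m < Q)%N ->
  \sum_(l < Q) cos (m%:R * node Q l) = 0.
Proof.
move=> /andP[m0 mQ]; have Q0 : 0 < Q%:R :> R by rewrite ltr0n (leq_trans _ mQ).
have p0 := @pi_gt0 R; have m0' : 0 < m%:R :> R by rewrite ltr0n.
pose f := pi * m%:R / Q%:R : R.
have sf : 0 < sin f.
  apply: sin_gt0_pi; rewrite /f -mulrA !mulr_gt0 ?invr_gt0//=.
  by rewrite gtr_pMr// ltr_pdivrMr// mul1r ltr_nat.
apply/eqP; rewrite -(mulrI_eq0 _ (lregP (lt0r_neq0 sf))) mulr_sumr.
pose s l := sin (f * (2 * l%:R - 1) - m%:R * pi) / 2 : R.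
rewrite (eq_bigr (fun l : 'I_Q => s l.+1 - s l)); last first.
  move=> l _; rewrite /s /node -[l.+1%:R]natr1.
  have -> : f * (2 * (l%:R + 1) - 1) - m%:R * pi =
     m%:R * (2 * pi * l%:R / Q%:R - pi) + f.
    by rewrite /f; field; rewrite gt_eqF.
  have -> : f * (2 * l%:R - 1) - m%:R * pi =
     m%:R * (2 * pi * l%:R / Q%:R - pi) - f.
    by rewrite /f; field; rewrite gt_eqF.
  by move: (m%:R * _) => x; rewrite sinD sinB; field.
rewrite -(big_mkord xpredT (fun l => s l.+1 - s l)) telescope_sumr//.
rewrite /s -mulrBl.
have -> : f * (2 * Q%:R - 1) - m%:R * pi =
   f * (2 * 0%:R - 1) - m%:R * pi + (pi *+ 2) *+ m.
  by rewrite /f -[in RHS](mulr_natl _ m) -[pi *+ 2](mulr_natl pi 2) mulr0n; field; rewrite gt_eqF.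
by rewrite (periodicn (@sinD2pi R)) subrr mul0r.
Qed.

Lemma sum_cos_node_delta Q m1 m2 : (m1 < Q)%N -> (m2 < Q)%N ->
  \sum_(l < Q) cos ((m1%:R - m2%:R) * node Q l) = Q%:R * (m1 == m2)%:R.
Proof.
wlog m12 : m1 m2 / (m1 <= m2)%N.
  move=> h m1Q m2Q; have [/h->//|/ltnW /h e] := leqP m1 m2.
  by rewrite eq_sym -e//; apply: eq_bigr => l _; rewrite -cosN -mulNr opprB.
move=> m1Q m2Q; have [->|ne] := eqVneq.
  rewrite mulr1 subrr; under eq_bigr do rewrite mul0r cos0.
  by rewrite sumr_const card_ord.
rewrite mulr0 -[RHS](@sum_cos_node Q (m2 - m1)); last first.
  by rewrite subn_gt0 ltn_neqAle ne m12 (leq_ltn_trans (leq_subr _ _)).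
by apply: eq_bigr => l _; rewrite natrB// -cosN -mulNr opprB.
Qed.

Definition bform n (A : 'M[R]_n) (u v : 'cV[R]_n) : R :=
  \sum_(i < n) \sum_(j < n) u i 0 * v j 0 * A i j.

Definition ucos M (u : 'cV[R]_M) t : R := \sum_(i < M) u i 0 * cos (i%:R * t).
Definition usin M (u : 'cV[R]_M) t : R := \sum_(i < M) u i 0 * sin (i%:R * t).

Lemma trig_bilinear M (u v : 'cV[R]_M) x t :
  cos (x * t) * (ucos v t * ucos u t + usin v t * usin u t)
  - sin (x * t) * (usin v t * ucos u t - ucos v t * usin u t) =
  \sum_(i < M) \sum_(j < M) u i 0 * v j 0 * cos ((x + j%:R - i%:R) * t).
Proof.
have prod (f g : 'I_M -> R) : (\sum_j f j) * (\sum_i g i) =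
    \sum_i \sum_j g i * f j.
  by rewrite mulrC mulr_suml; apply: eq_bigr => i _; rewrite mulr_sumr.
rewrite /ucos /usin !prod -sumrB -big_split !mulr_sumr -sumrB /=.
apply: eq_bigr => i _; rewrite -sumrB -big_split !mulr_sumr -sumrB /=.
apply: eq_bigr => j _.
have -> : (x + j%:R - i%:R) * t = x * t + (j%:R * t - i%:R * t) by ring.
by rewrite cosD cosB sinB; ring.
Qed.

(** Re (g V conj U), where U and V are the trigonometric polynomials with coefficients
    u and v. *)
Definition symbol_pairing alpha n M (u v : 'cV[R]_M) t : R :=
  symbol_cos alpha n t * (ucos v t * ucos u t + usin v t * usin u t)
  - symbol_sin alpha n t * (usin v t * ucos u t - ucos v t * usin u t).

Lemma symbol_pairingE alpha n M (u v : 'cV[R]_M) t :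
  symbol_pairing alpha n u v t =
  \sum_(i < M) \sum_(j < M) u i 0 * v j 0 * \sum_(k < n.+1) gcoef alpha k *
    (alpha / 2 * cos (((k + j)%:R - i.+1%:R) * t) +
     (1 - alpha / 2) * cos (((k + j)%:R - i%:R) * t)).
Proof.
rewrite /symbol_pairing /symbol_cos /symbol_sin.
transitivity (\sum_(k < n.+1) gcoef alpha k *
  (alpha / 2 * (\sum_(i < M) \sum_(j < M)
       u i 0 * v j 0 * cos ((k%:R - 1 + j%:R - i%:R) * t)) +
   (1 - alpha / 2) * (\sum_(i < M) \sum_(j < M)
       u i 0 * v j 0 * cos ((k%:R + j%:R - i%:R) * t)))).
  set X := (ucos v t * _ + _); set Y := (usin v t * _ - _).
  rewrite !mulr_suml -sumrB; apply: eq_bigr => k _.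
  by rewrite -!trig_bilinear -/X -/Y; ring.
transitivity (\sum_(k < n.+1) \sum_(i < M) \sum_(j < M) gcoef alpha k *
  (alpha / 2 * (u i 0 * v j 0 * cos ((k%:R - 1 + j%:R - i%:R) * t)) +
   (1 - alpha / 2) * (u i 0 * v j 0 * cos ((k%:R + j%:R - i%:R) * t)))).
  apply: eq_bigr => k _; rewrite !mulr_sumr -big_split mulr_sumr.
  apply: eq_bigr => i _; rewrite !mulr_sumr -big_split mulr_sumr.
  by apply: eq_bigr.
rewrite exchange_big; apply: eq_bigr => i _ /=.
rewrite exchange_big; apply: eq_bigr => j _ /=.
rewrite mulr_sumr; apply: eq_bigr => k _.
have -> : (k + j)%:R - i.+1%:R = k%:R - 1 + j%:R - i%:R :> R.
  by rewrite natrD -natr1; ring.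
by rewrite natrD; ring.
Qed.

Lemma sum_gcoef_delta alpha n j m : (m <= n)%N ->
  \sum_(k < n.+1) gcoef alpha k * ((k + j)%N == m)%:R =
  if (j <= m)%N then gcoef alpha (m - j) else 0.
Proof.
move=> mn; case: ifPn => jm; last first.
  apply: big1 => k _; rewrite (_ : (_ == _) = false) ?mulr0//.
  by apply/negbTE; lia.
have mjn : (m - j < n.+1)%N by lia.
rewrite (bigD1 (Ordinal mjn))//= big1 ?addr0 ?subnK// ?eqxx ?mulr1// => k kne.
rewrite (_ : (_ == _) = false) ?mulr0//.
by apply: contraNF kne => /eqP kj; apply/eqP/val_inj => /=; lia.
Qed.

(** A discrete Parseval identity: with more nodes than the degree of the
    trigonometric polynomial only the constant terms survive, and truncating the
    symbol at n >= M leaves the M x M matrix unchanged. *)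
Lemma avg_symbol_pairing alpha n M Q (u v : 'cV[R]_M) :
  (M <= n)%N -> (n + M < Q)%N ->
  \sum_(l < Q) symbol_pairing alpha n u v (node Q l) =
  Q%:R * bform (Gmx alpha M) u v.
Proof.
move=> Mn nQ; under eq_bigr do rewrite symbol_pairingE.
rewrite exchange_big mulr_sumr; apply: eq_bigr => i _ /=.
rewrite exchange_big mulr_sumr; apply: eq_bigr => j _ /=.
rewrite -mulr_sumr exchange_big/= mulrCA; congr (_ * _).
have ltiM := ltn_ord i; have ltjM := ltn_ord j.
transitivity (Q%:R * \sum_(k < n.+1) gcoef alpha k *
   (alpha / 2 * ((k + j)%N == i.+1)%:R + (1 - alpha / 2) * ((k + j)%N == i)%:R)).
  rewrite mulr_sumr; apply: eq_bigr => k _.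
  rewrite -mulr_sumr big_split/= -!mulr_sumr.
  have ltk := ltn_ord k.
  by rewrite !sum_cos_node_delta; [ring|lia..].
congr (_ * _); under eq_bigr do rewrite mulrDr ![gcoef _ _ * (_ * _)]mulrCA.
rewrite big_split/= -!mulr_sumr !sum_gcoef_delta; [|lia..].
rewrite mxE; have [ji|ij] := leqP j i; last first.
  rewrite mulr0 addr0; case: ifPn => [ji1|]; last by rewrite mulr0.
  by rewrite (_ : j = i.+1 :> nat) ?subnn//; lia.
by rewrite leqW// subSn//= ; congr (_ + _ * _); field.
Qed.

(** Changing t to - t conjugates the symbol, hence amounts to conjugating U and V. *)
Lemma symbol_sector_form_even alpha n t Uc Us Vc Vs :
  1 < alpha < 2 -> (1 <= n)%N -> - pi <= t <= pi ->
  - (6 * tail_weight alpha n * (Uc ^+ 2 + Us ^+ 2 + Vc ^+ 2 + Vs ^+ 2)) <=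
  sector_form `|cos (alpha / 2 * pi)| (symbol_cos alpha n t) (symbol_sin alpha n t)
    Uc Us Vc Vs.
Proof.
move=> a12 n1 /andP[t1 t2]; have [t0|t0] := leP 0 t.
  by apply: symbol_sector_form_ge; rewrite ?t0.
have := @symbol_sector_form_ge _ alpha n (- t) Uc (- Us) Vc (- Vs) a12 n1 _.
rewrite !sqrrN => h; apply: le_trans (h _) _; first by rewrite lerNl t1 lerNr oppr0 ltW.
have -> : symbol_cos alpha n (- t) = symbol_cos alpha n t.
  by apply: eq_bigr => k _; rewrite !mulrN !cosN.
have -> : symbol_sin alpha n (- t) = - symbol_sin alpha n t.
  by rewrite -sumrN; apply: eq_bigr => k _; rewrite !mulrN !sinN; ring.
by rewrite le_eqVlt; apply/orP; left; apply/eqP; rewrite /sector_form; ring.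
Qed.

Lemma ucos_norm M (u : 'cV[R]_M) t : `|ucos u t| <= \sum_(i < M) `|u i 0|.
Proof.
apply: le_trans (ler_norm_sum _ _ _) _; apply: ler_sum => i _.
by rewrite normrM ler_piMr// cos_max.
Qed.

Lemma usin_norm M (u : 'cV[R]_M) t : `|usin u t| <= \sum_(i < M) `|u i 0|.
Proof.
apply: le_trans (ler_norm_sum _ _ _) _; apply: ler_sum => i _.
by rewrite normrM ler_piMr// sin_max.
Qed.

(** The numerical range of G lies in a sector of half-angle pi (1 - a), in bilinear
    form.  Averaging the pointwise inequality leaves an error proportional to
    eps_n, with a factor B that does not depend on n. *)
Lemma sector_Gmx alpha M (u v : 'cV[R]_M) : 1 < alpha < 2 ->
  2 * varsigma alpha * bform (Gmx alpha M) u v <=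
  - bform (Gmx alpha M) u u - bform (Gmx alpha M) v v.
Proof.
move=> a12; have a12' : 1 <= alpha <= 2 by have [a1 a2] := andP a12; rewrite !ltW.
set vs := varsigma alpha; set G := Gmx alpha M.
pose B := 2 * ((\sum_(i < M) `|u i 0|) ^+ 2 + (\sum_(i < M) `|v i 0|) ^+ 2).
have B0 : 0 <= B by rewrite mulr_ge0// addr_ge0 ?sqr_ge0.
suff main n : (M < n)%N -> - (6 * tail_weight alpha n * B) <=
    - bform G u u - bform G v v - 2 * vs * bform G u v.
  rewrite -subr_le0; apply/ler_addgt0Pr => e e0; rewrite add0r.
  have e0' : 0 < e / (6 * (B + 1)) by rewrite divr_gt0// mulr_gt0//; lra.
  have [N HN] := tail_weight_small a12' e0'.
  have {HN} := HN (maxn N M.+1) (leq_maxl _ _).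
  rewrite ler_pdivlMr; last by rewrite mulr_gt0//; lra.
  have := main _ (leq_maxr N M.+1).
  have : 0 <= tail_weight alpha (maxn N M.+1).
    by apply: tail_weight_ge0 => //; lia.
  by move: (tail_weight _ _) => w; nra.
move=> Mn; have n1 : (1 <= n)%N by case: n Mn.
pose Q := (n + M).+1; have Q0 : 0 < Q%:R :> R by [].
rewrite -(ler_pM2l Q0).
have -> : Q%:R * (- bform G u u - bform G v v - 2 * vs * bform G u v) =
    \sum_(l < Q) sector_form vs
      (symbol_cos alpha n (node Q l)) (symbol_sin alpha n (node Q l))
      (ucos u (node Q l)) (usin u (node Q l)) (ucos v (node Q l)) (usin v (node Q l)).
  transitivity (- \sum_(l < Q) symbol_pairing alpha n u u (node Q l)
    - \sum_(l < Q) symbol_pairing alpha n v v (node Q l)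
    - 2 * vs * \sum_(l < Q) symbol_pairing alpha n u v (node Q l)).
    by rewrite !avg_symbol_pairing ?(ltnW Mn)//; ring.
  rewrite mulr_sumr -!sumrN -!big_split/=; apply: eq_bigr => l _.
  by rewrite /symbol_pairing /sector_form; ring.
have -> : Q%:R * - (6 * tail_weight alpha n * B) =
    \sum_(l < Q) - (6 * tail_weight alpha n * B).
  by rewrite sumr_const card_ord mulr_natl.
apply: ler_sum => l _.
apply: le_trans (symbol_sector_form_even _ _ _ _ a12 n1 (node_itv (ltn_ord l))).
rewrite lerN2 ler_wpM2l//; first by rewrite mulr_ge0// tail_weight_ge0.
have sq (x y : R) : `|x| <= y -> x ^+ 2 <= y ^+ 2.
  by rewrite ler_norml => /andP[? ?]; nra.
have := sq _ _ (ucos_norm u (node Q l)); have := sq _ _ (usin_norm u (node Q l)).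
have := sq _ _ (ucos_norm v (node Q l)); have := sq _ _ (usin_norm v (node Q l)).
by rewrite /B; lra.
Qed.

End Averaging.

(** * Multiplication by a convex sequence in the energy norm *)

Section Dirichlet.
Variable R : realType.
Implicit Types (alpha kap : R) (M : nat).

(** Expand the square (y_i - y_j)^2; the part antisymmetric in i and j sums to 0.
    For w = 1 this is the usual decomposition of a Dirichlet form into killing and
    jump parts. *)
Lemma dirichlet_identity n (H : 'M[R]_n) (w : 'I_n -> R) (y : 'cV[R]_n) :
  (forall i j, H i j = H j i) ->
  bform H (\col_i (w i * y i 0)) (\col_i (w i * y i 0)) =
  \sum_i w i * y i 0 ^+ 2 * (\sum_j H i j * w j)
  - 2^-1 * \sum_i \sum_j H i j * (w i * w j) * (y i 0 - y j 0) ^+ 2.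
Proof.
move=> Hsym; pose D i j : R := H i j * (w i * w j) * (y j 0 ^+ 2).
have DC : \sum_i \sum_j D i j = \sum_i \sum_j D j i by rewrite exchange_big.
transitivity (\sum_i w i * y i 0 ^+ 2 * (\sum_j H i j * w j)
  - 2^-1 * \sum_i \sum_j H i j * (w i * w j) * (y i 0 - y j 0) ^+ 2
  + 2^-1 * (\sum_i \sum_j D i j - \sum_i \sum_j D j i)); last first.
  by rewrite DC subrr mulr0 addr0.
rewrite !mulr_sumr -!sumrB mulr_sumr -big_split/=; apply: eq_bigr => i _.
rewrite !mulr_sumr -!sumrB mulr_sumr -big_split/=; apply: eq_bigr => j _.
by rewrite /D !mxE [H j i]Hsym; field.
Qed.

(** In the decomposition of the form at w y, the jump weights w_i w_j are at most
    kap^2, and the killing part w_i (H w)_i is at most 2 w_i^2 r_i, where r_i is the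
    row sum. *)
Lemma dirichlet_multiplier n (H : 'M[R]_n) (w : 'I_n -> R) kap (y : 'cV[R]_n) :
  (forall i j, H i j = H j i) -> (forall i j, i != j -> H i j <= 0) ->
  (forall i, 0 <= w i <= kap) -> (forall i, 0 <= \sum_j H i j) ->
  (forall i, \sum_j H i j * w j <= 2 * w i * \sum_j H i j) ->
  bform H (\col_i (w i * y i 0)) (\col_i (w i * y i 0)) <=
  2 * kap ^+ 2 * bform H y y.
Proof.
move=> Hsym Hoff w0 r0 Hw.
have -> : bform H y y = bform H (\col_i (1 * y i 0)) (\col_i (1 * y i 0)).
  by congr bform; apply/colP => i; rewrite mxE mul1r.
rewrite (dirichlet_identity w y Hsym) (dirichlet_identity (fun=> 1) y Hsym).
rewrite mulrBr; apply: lerB.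
  rewrite mulr_sumr; apply: ler_sum => i _; have /andP[wi0 wik] := w0 i.
  under [in leRHS]eq_bigr do rewrite mulr1.
  apply: (@le_trans _ _ (w i * y i 0 ^+ 2 * (2 * w i * \sum_j H i j))).
    by apply: ler_wpM2l; [rewrite mulr_ge0 ?sqr_ge0|exact: Hw].
  have -> : w i * y i 0 ^+ 2 * (2 * w i * (\sum_j H i j)) =
     2 * w i ^+ 2 * (y i 0 ^+ 2 * \sum_j H i j) by ring.
  rewrite mul1r; apply: ler_wpM2r.
    by apply: mulr_ge0; rewrite ?sqr_ge0.
  by rewrite ler_wpM2l// ler_sqr ?nnegrE// (le_trans wi0).
rewrite mulrCA ler_wpM2l// mulr_sumr; apply: ler_sum => i _.
rewrite mulr_sumr; apply: ler_sum => j _; have [->|ij] := eqVneq i j.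
  by rewrite subrr expr0n !mulr0.
rewrite [leLHS]mulrA; apply: ler_wpM2r; first exact: sqr_ge0.
have := Hoff _ _ ij; have /andP[wi0 wik] := w0 i; have /andP[wj0 wjk] := w0 j.
have : w i * w j <= kap * kap by rewrite ler_pM.
have : 0 <= kap * kap by rewrite -expr2 sqr_ge0.
by rewrite -expr2; move: (w i * w j) (kap ^+ 2) => x k; nra.
Qed.

Lemma sum_around (F : nat -> R) M i : (i < M)%N ->
  \sum_(j < M) F j = F i + \sum_(k < M)
    ((if (k < i)%N then F (i - k.+1)%N else 0) +
     (if (i + k.+1 < M)%N then F (i + k.+1)%N else 0)).
Proof.
move=> iM; rewrite big_split/=.
have -> : \sum_(k < M) (if (k < i)%N then F (i - k.+1)%N else 0) =
    \sum_(0 <= k < i) F k.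
  rewrite -big_mkcond/= -(big_ord_widen _ (fun k => F (i - k.+1)%N) (ltnW iM)).
  by rewrite big_nat_rev/= big_mkord; apply: eq_bigr => k _; rewrite add0n.
have -> : \sum_(k < M) (if (i + k.+1 < M)%N then F (i + k.+1)%N else 0) =
    \sum_(i.+1 <= k < M) F k.
  rewrite -big_mkcond/= (eq_bigl (fun k : 'I_M => k < M - i.+1)%N); last first.
    by move=> k /=; rewrite ltn_subRL addnS addSn.
  rewrite -(big_ord_widen _ (fun k => F (i + k.+1)%N) (leq_subr _ _)).
  rewrite -[X in \sum_(X <= _ < _) _]add0n big_addn big_mkord.
  by apply: eq_bigr => k _; rewrite addnS -addSn addnC.
rewrite -(big_mkord xpredT F) (big_cat_nat (leq0n i) (ltnW iM))/=.
by rewrite (big_ltn iM); ring.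
Qed.

(** The opposite of the entry of - (G + G^T) / 2 at distance k + 1 from the diagonal.
    The superdiagonal of G holds w_0, whence the extra term at k = 0. *)
Definition wsym alpha k : R := (wcoef alpha k.+2 + (k == 0%N)%:R * wcoef alpha 0) / 2.

Lemma wsym_ge0 alpha k : 1 <= alpha <= 2 -> 0 <= wsym alpha k.
Proof.
move=> a12; rewrite divr_ge0//; case: k => [|k].
  by rewrite mul1r addrC wcoef0D2_ge0.
by rewrite mul0r addr0 wcoef_ge0.
Qed.

Definition symG alpha M : 'M[R]_M :=
  - 2^-1 *: (Gmx alpha M + (Gmx alpha M)^T).

(** The Toeplitz kernel of symG on all naturals, so that a row can be summed by the
    distance to the diagonal. *)
Definition symG_entry alpha (i j : nat) : R :=
  - 2^-1 * ((if (j <= i.+1)%N then wcoef alpha (i.+1 - j)%N else 0) +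
            (if (i <= j.+1)%N then wcoef alpha (j.+1 - i)%N else 0)).

Lemma symGE alpha M i j : symG alpha M i j = symG_entry alpha i j.
Proof. by rewrite !mxE. Qed.

Lemma symG_sym alpha M i j : symG alpha M i j = symG alpha M j i.
Proof. by rewrite !mxE addrC. Qed.

Lemma symG_entryC alpha i j : symG_entry alpha i j = symG_entry alpha j i.
Proof. by rewrite /symG_entry addrC. Qed.

Lemma symG_entry_diag alpha i : symG_entry alpha i i = - wcoef alpha 1.
Proof. by rewrite /symG_entry leqW// subSnn; field. Qed.

Lemma symG_entry_off alpha i k : symG_entry alpha (i + k.+1)%N i = - wsym alpha k.
Proof.
rewrite /symG_entry /wsym leqW ?leq_addr// -addnS addKn.
case: k => [|k].
  by rewrite addn1 leqnn subnn mul1r mulNr mulrC.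
rewrite ifF ?mul0r; last by lia.
by rewrite mulNr mulrC.
Qed.

Lemma symG_off_le0 alpha M i j : 1 <= alpha <= 2 -> i != j -> symG alpha M i j <= 0.
Proof.
move=> a12; wlog ij : i j / (j < i)%N.
  move=> h ne; have [/h->//|ij|/val_inj e] := ltngtP j i; last by rewrite e eqxx in ne.
  by rewrite symG_sym h// eq_sym.
move=> _; rewrite symGE -(subnKC ij) addSnnS symG_entry_off.
by rewrite oppr_le0 wsym_ge0.
Qed.

(** At each distance k + 1 from i, the neighbours inside the grid contribute at most
    2 e_i wsym_k to the sum of wsym (2 e_i - e_j): by convexity if there are two of
    them, by e_j >= 0 if there is one.  The diagonal entry - w_1 absorbs all
    of this because w_0 + ... + w_{M+1} <= 0. *)
Lemma symG_convex_row alpha M (e : nat -> R) (i : 'I_M) : 1 <= alpha <= 2 ->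
  (forall j, (j < M)%N -> 0 <= e j) ->
  (forall j k, (k <= j)%N -> (j + k < M)%N -> 2 * e j <= e (j - k)%N + e (j + k)%N) ->
  \sum_j symG alpha M i j * e j <= 2 * e i * \sum_j symG alpha M i j.
Proof.
move=> a12 e0 conv; rewrite -subr_ge0 mulr_sumr -sumrB.
pose F j := symG_entry alpha i j * (2 * e i - e j).
rewrite (eq_bigr (fun j : 'I_M => F j)); last first.
  by move=> j _; rewrite symGE /F; ring.
have iM := ltn_ord i.
rewrite (sum_around F iM) {1}/F symG_entry_diag.
have : \sum_(k < M) - (2 * wsym alpha k * e i) <= \sum_(k < M)
    ((if (k < i)%N then F (i - k.+1)%N else 0) +
     (if (i + k.+1 < M)%N then F (i + k.+1)%N else 0)).
  apply: ler_sum => k _; have h0 := wsym_ge0 k a12; have ei0 := e0 _ iM.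
  have he0 : 0 <= wsym alpha k * e i by rewrite mulr_ge0.
  have Fl : (k < i)%N -> F (i - k.+1)%N = - wsym alpha k * (2 * e i - e (i - k.+1)%N).
    by move=> ki; rewrite /F -{1}(subnK ki) symG_entry_off.
  have Fr : F (i + k.+1)%N = - wsym alpha k * (2 * e i - e (i + k.+1)%N).
    by rewrite /F symG_entryC symG_entry_off.
  case: ifPn => [ki|_]; case: ifPn => [ikM|_]; rewrite ?Fl ?Fr//.
  - have := conv _ _ ki ikM; nra.
  - have := e0 (i - k.+1)%N ltac:(lia); nra.
  - have := e0 (i + k.+1)%N ikM; nra.
  - lra.
case: M i e0 conv F iM => [|m] i e0 conv F iM; first by case: i iM.
have -> : \sum_(k < m.+1) - (2 * wsym alpha k * e i) =
    - ((wcoef alpha 0 + \sum_(k < m.+1) wcoef alpha k.+2) * e i).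
  rewrite sumrN -mulr_suml; congr (- (_ * _)).
  rewrite (eq_bigr (fun k : 'I_m.+1 =>
      wcoef alpha k.+2 + (k == 0%N :> nat)%:R * wcoef alpha 0)); last first.
    by move=> k _; rewrite /wsym; field.
  rewrite big_split/= addrC; congr (_ + _).
  by rewrite big_ord_recl/= mul1r big1 ?addr0// => k _; rewrite mul0r.
have := sum_wcoef_le0 m a12; have := e0 _ iM.
have -> : \sum_(k < m.+3) wcoef alpha k =
    wcoef alpha 0 + (wcoef alpha 1 + \sum_(k < m.+1) wcoef alpha k.+2).
  by rewrite 2!big_ord_recl.
move: (wcoef alpha 0) (wcoef alpha 1) (\sum_(k < m.+1) wcoef _ _) => w0 w1 S.
move: (\sum_(k < m.+1) _) => T ei0 w_le0 leT; nra.
Qed.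

End Dirichlet.

(** * Forms, singular values and condition number *)

Section Energy.
Variable R : realType.
Implicit Types (n : nat) (kap : R).

Definition sqnorm n (v : 'cV[R]_n) : R := \sum_(i < n) v i 0 ^+ 2.

Lemma sqnorm_ge0 n (v : 'cV[R]_n) : 0 <= sqnorm v.
Proof. by apply: sumr_ge0 => i _; exact: sqr_ge0. Qed.

Lemma sqnorm_eq0 n (v : 'cV[R]_n) : (sqnorm v == 0) = (v == 0).
Proof.
rewrite psumr_eq0; last by move=> i _; exact: sqr_ge0.
apply/allP/eqP => [v0|-> i _]; last by rewrite mxE expr0n eqxx.
apply/colP => i; rewrite mxE; apply/eqP.
by have := v0 i (mem_index_enum _); rewrite /= sqrf_eq0.
Qed.

Lemma sqnormE n (v : 'cV[R]_n) : sqnorm v = (v^T *m v) 0 0.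
Proof. by rewrite mxE; apply: eq_bigr => i _; rewrite mxE expr2. Qed.

Lemma sqnorm_inj_unitmx n (C : 'M[R]_n) c : 0 < c ->
  (forall x, c * sqnorm x <= sqnorm (C *m x)) -> C \in unitmx.
Proof.
move=> c0 Cc; rewrite -unitmx_tr -row_free_unit; apply: inj_row_free => v vC.
apply: trmx_inj; apply/eqP; rewrite trmx0 -sqnorm_eq0 eq_le sqnorm_ge0 andbT.
rewrite -(pmulr_rle0 _ c0) (le_trans (Cc _))// -[C]trmxK -trmx_mul vC trmx0.
by rewrite /sqnorm big1// => i _; rewrite mxE expr0n.
Qed.

Lemma mxnorm2_bounds n (B : 'M[R]_n) c :
  (forall x, sqnorm (B *m x) <= c * sqnorm x) -> 0 <= mxnorm2 B <= Num.sqrt c.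
Proof.
move=> Bc.
have c_ub : ubound [set norm2 (B *m v) | v in [set v | norm2 v <= 1]] (Num.sqrt c).
  move=> _ [v /= v1 <-]; apply: le_trans (ler_wsqrtr (Bc v)) _.
  have [c0|c0] := leP 0 c; last first.
    rewrite ler0_sqrtr; first exact: sqrtr_ge0.
    by rewrite nmulr_rle0 ?sqnorm_ge0.
  by rewrite sqrtrM// ler_piMr ?sqrtr_ge0.
have z : [set norm2 (B *m v) | v in [set v | norm2 v <= 1]] 0.
  have n0 : norm2 (0 : 'cV[R]_n) = 0.
    by rewrite /norm2 big1 ?sqrtr0// => i _; rewrite mxE expr0n.
  by exists 0; rewrite /= ?mulmx0 n0.
apply/andP; split; last by apply: ge_sup => //; exists 0.
by apply: ub_le_sup z; exists (Num.sqrt c).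
Qed.

Section Sandwich.
Variables (n : nat) (C : 'M[R]_n) (lo hi : R).
Variable (lo0 : 0 < lo).
Variable (C_lo : forall x, lo * sqnorm x <= sqnorm (C *m x)).
Variable (C_hi : forall x, sqnorm (C *m x) <= hi * sqnorm x).

Lemma sq_singular_values_sandwich : sq_singular_values C `<=` `[lo, hi].
Proof.
move=> _ [s [_ /eigenvalueP[v vC v0]] <-].
have x0 : 0 < sqnorm v^T.
  by rewrite lt_neqAle sqnorm_ge0 eq_sym sqnorm_eq0 andbT trmx_eq0.
have Cx : sqnorm (C *m v^T) = s ^+ 2 * sqnorm v^T.
  by rewrite !sqnormE trmx_mul !trmxK mulmxA -[v *m _ *m C]mulmxA vC -scalemxAl mxE.
have := C_lo v^T; have := C_hi v^T; rewrite Cx /= in_itv/=.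
by rewrite !ler_pM2r// => -> ->.
Qed.

Lemma cond2_sandwich : cond2 C <= Num.sqrt (hi / lo).
Proof.
have Cu := sqnorm_inj_unitmx lo0 C_lo.
have /andP[nC0 nC] := mxnorm2_bounds C_hi.
have /andP[nI0 nI] : 0 <= mxnorm2 (invmx C) <= Num.sqrt lo^-1.
  apply: mxnorm2_bounds => x; rewrite -(ler_pM2l lo0) mulVKf ?gt_eqF//.
  by apply: le_trans (C_lo _) _; rewrite mulKVmx.
apply: le_trans (ler_pM nC0 nI0 nC nI) _.
by rewrite mulrC -sqrtrM ?invr_ge0 ?(ltW lo0)// [lo^-1 * _]mulrC.
Qed.

End Sandwich.

Lemma bformE n (A : 'M[R]_n) (u v : 'cV[R]_n) :
  bform A u v = \sum_i u i 0 * (A *m v) i 0.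
Proof.
apply: eq_bigr => i _; rewrite mxE mulr_sumr; apply: eq_bigr => j _.
by rewrite -mulrA [v j 0 * _]mulrC.
Qed.

Lemma bformZl n (A : 'M[R]_n) c (u v : 'cV[R]_n) :
  bform A (c *: u) v = c * bform A u v.
Proof. by rewrite !bformE mulr_sumr; apply: eq_bigr => i _; rewrite mxE mulrA. Qed.

Lemma bformZr n (A : 'M[R]_n) c (u v : 'cV[R]_n) :
  bform A u (c *: v) = c * bform A u v.
Proof.
rewrite !bformE mulr_sumr; apply: eq_bigr => i _.
by rewrite -scalemxAr mxE mulrCA.
Qed.

Lemma bform_symG alpha M (y : 'cV[R]_M) :
  bform (symG alpha M) y y = - bform (Gmx alpha M) y y.
Proof.
pose b i j := y i 0 * y j 0 * Gmx alpha M i j.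
have E : \sum_i \sum_j b i j = \sum_i \sum_j b j i by rewrite exchange_big.
transitivity (- 2^-1 * (\sum_i \sum_j b i j + \sum_i \sum_j b j i)).
  rewrite -big_split mulr_sumr; apply: eq_bigr => i _.
  rewrite -big_split mulr_sumr; apply: eq_bigr => j _.
  by rewrite [symG _ _ _ _]mxE [(_ + _^T) _ _]mxE [_^T _ _]mxE /b /=; ring.
by rewrite -E /bform /b; field.
Qed.

Lemma bform_Gmx_le0 alpha M (y : 'cV[R]_M) : 1 < alpha < 2 ->
  bform (Gmx alpha M) y y <= 0.
Proof.
move=> a12; have := sector_Gmx y 0 a12.
by rewrite -[0 : 'cV_M](scale0r 0) !bformZl !bformZr; lra.
Qed.

Lemma varsigma_gt0 alpha : 1 < alpha < 2 -> 0 < varsigma alpha :> R.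
Proof.
move=> a12; rewrite normr_gt0 lt_eqF//; apply: cos_api_lt0.
by have [a1 a2] := andP a12; apply/andP; split; lra.
Qed.

(** Both ingredients meet here: the sector inequality for the vectors
    E y / (sqrt 2 kap) and y or - y, then the bound on the energy of E y, which
    makes the first vector cost no more than y itself. *)
Lemma convex_multiplier_form alpha M (e : nat -> R) kap (y : 'cV[R]_M) :
  1 < alpha < 2 -> 0 <= kap ->
  (forall j, (j < M)%N -> 0 <= e j <= kap) ->
  (forall j k, (k <= j)%N -> (j + k < M)%N -> 2 * e j <= e (j - k)%N + e (j + k)%N) ->
  `|bform (Gmx alpha M) (\col_i (e i * y i 0)) y| <=
  Num.sqrt 2 * kap / varsigma alpha * - bform (Gmx alpha M) y y.
Proof.
move=> a12 k_ge0 ek conv.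
have a12' : 1 <= alpha <= 2 by have [a1 a2] := andP a12; rewrite !ltW.
set G := Gmx alpha M; set ey := \col_i _; set h := - bform G y y.
have h0 : 0 <= h by rewrite oppr_ge0 bform_Gmx_le0.
have vs0 := varsigma_gt0 a12.
have row0 (i : 'I_M) : 0 <= \sum_j symG alpha M i j.
  (* Constants are convex: the row inequality for e = 1 reads r_i <= 2 r_i. *)
  suff : \sum_j symG alpha M i j * 1 <= 2 * 1 * \sum_j symG alpha M i j.
    by under eq_bigr do rewrite mulr1; lra.
  by apply: (@symG_convex_row _ alpha M (fun=> 1)) => // *; lra.
have eyb : - bform G ey ey <= 2 * kap ^+ 2 * h.
  rewrite /h -!bform_symG; apply: (@dirichlet_multiplier _ _ _ (fun i => e i)) => //.
  - by move=> i j; exact: symG_sym.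
  - by move=> i j; exact: symG_off_le0.
  - by move=> i; exact: ek.
  - by move=> i; apply: symG_convex_row => // j jM; have /andP[] := ek _ jM.
move: k_ge0; rewrite le_eqVlt => /predU1P[k0|k0].
  have -> : ey = 0 *: ey.
    apply/colP => i; rewrite !mxE mul0r.
    have := ek _ (ltn_ord i); rewrite -k0 => ei.
    by rewrite (_ : e i = 0) ?mul0r//; apply/eqP; rewrite eq_le andbC.
  by rewrite bformZl mul0r normr0 -k0 mulr0 !mul0r.
set r := Num.sqrt 2 * kap; have r0 : 0 < r by rewrite mulr_gt0 ?sqrtr_gt0.
have r2 : r ^+ 2 = 2 * kap ^+ 2 by rewrite exprMn sqr_sqrtr.
have half s : s ^+ 2 = 1 -> s * bform G ey y <= r / varsigma alpha * h.
  move=> s2; have := sector_Gmx (r^-1 *: ey) (s *: y) a12.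
  rewrite -/G !bformZl !bformZr.
  have -> : - (s * (s * bform G y y)) = h by rewrite mulrA -expr2 s2 mul1r.
  have -> : - (r^-1 * (r^-1 * bform G ey ey)) = (r ^+ 2)^-1 * - bform G ey ey.
    by rewrite mulrA -expr2 exprVn mulrN.
  have : (r ^+ 2)^-1 * - bform G ey ey <= h.
    by rewrite ler_pdivrMl ?exprn_gt0// r2.
  move=> h1 h2.
  have : varsigma alpha * (r^-1 * (s * bform G ey y)) <= h by lra.
  rewrite mulrCA ler_pdivrMl// -ler_pdivlMl// => /le_trans; apply.
  by rewrite le_eqVlt; apply/orP; left; apply/eqP; ring.
rewrite ler_norml -lerN2 opprK; apply/andP; split.
  by rewrite -mulN1r half// sqrrN expr1n.
by rewrite -[X in X <= _]mul1r half// expr1n.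
Qed.

End Energy.

(** * Comparison of the matrix with its preconditioner *)

Section Comparison.
Variable R : realType.

Lemma sqnorm_step n (G : 'M[R]_n) (w : 'I_n -> R) (c : R) (y : 'cV[R]_n) :
  sqnorm ((1%:M - c *: (diag_mx (\row_i w i) *m G)) *m y) =
  sqnorm y - 2 * c * bform G (\col_i (w i * y i 0)) y
  + c ^+ 2 * \sum_i w i ^+ 2 * (G *m y) i 0 ^+ 2.
Proof.
rewrite bformE mulr_sumr mulr_sumr /sqnorm -sumrN -!big_split /=.
apply: eq_bigr => i _.
rewrite mulmxBl mul1mx -scalemxAl -mulmxA mul_diag_mx.
by rewrite !mxE; ring.
Qed.

Lemma concave_midpoint (S : set R) (f : R -> R) (x y : R) :
  concave_function S f -> S x -> S y ->
  f x + f y <= 2 * f ((x + y) / 2).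
Proof.
move=> fc Sx Sy.
have h0 : 0 <= (2^-1 : R) <= 1 by apply/andP; split; lra.
have := fc (Itv01 (proj1 (andP h0)) (proj2 (andP h0))) x y (mem_set Sx) (mem_set Sy).
set t := Itv01 _ _ => fle.
have {}fle : - f (2^-1 * x + (1 - 2^-1) * y) <= 2^-1 * - f x + (1 - 2^-1) * - f y.
  exact: fle.
have -> : (x + y) / 2 = 2^-1 * x + (1 - 2^-1) * y by field.
lra.
Qed.



(** What the minimum is chosen for, term by term in powers of eta; k will be the
    mean of d. *)
Lemma s_check_bounds (alpha kmin kmax k : R) :
  0 < kmin -> kmin <= k <= kmax -> 0 <= nu alpha kmin kmax ->
  0 < kmax - nu alpha kmin kmax ->
  [/\ 0 < s_check alpha kmin kmax, s_check alpha kmin kmax <= 1,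
      s_check alpha kmin kmax * k <= kmax - nu alpha kmin kmax &
      s_check alpha kmin kmax * k ^+ 2 <= kmin ^+ 2].
Proof.
move=> kmin0 /andP[k1 k2]; rewrite /s_check; move: (nu _ _ _) => v v0 vk.
have k0 : 0 < k by exact: lt_le_trans k1.
have kmax0 : 0 < kmax by exact: lt_le_trans k2.
set m := Num.min _ _.
have m0 : 0 < m by rewrite lt_min !divr_gt0// exprn_gt0.
have m1 : m * kmax <= kmax - v by rewrite -ler_pdivlMr// ge_min lexx.
have m2 : m * kmax ^+ 2 <= kmin ^+ 2.
  by rewrite -ler_pdivlMr ?exprn_gt0// ge_min lexx orbT.
split => //.
- by rewrite -(ler_pM2r kmax0); lra.
- by apply: le_trans m1; rewrite ler_pM2l.
- by apply: le_trans m2; rewrite ler_pM2l// ler_sqr ?nnegrE ?(ltW k0) ?(ltW kmax0).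
Qed.

Lemma s_hat_bounds (alpha kmin kmax k : R) :
  0 < kmin -> kmin <= k <= kmax -> 0 <= nu alpha kmin kmax ->
  [/\ 1 <= s_hat alpha kmin kmax,
      kmax + nu alpha kmin kmax <= s_hat alpha kmin kmax * k &
      kmax ^+ 2 <= s_hat alpha kmin kmax * k ^+ 2].
Proof.
move=> kmin0 /andP[k1 k2]; rewrite /s_hat; move: (nu _ _ _) => v v0.
have k0 : 0 < k by exact: lt_le_trans k1.
have kmax0 : 0 < kmax by exact: lt_le_trans k2.
set m := Num.max _ _.
have m1 : kmax + v <= m * kmin by rewrite -ler_pdivrMr// le_max lexx.
have m2 : kmax ^+ 2 <= m * kmin ^+ 2.
  by rewrite -ler_pdivrMr ?exprn_gt0// le_max lexx orbT.
have m0 : 0 < m.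
  by rewrite lt_max divr_gt0// ltr_wpDr.
split => //.
- by rewrite -(ler_pM2r kmin0); lra.
- by apply: le_trans m1 _; rewrite ler_pM2l.
- by apply: le_trans m2 _; rewrite ler_pM2l// ler_sqr ?nnegrE ?(ltW kmin0) ?(ltW k0).
Qed.

(** Compare the terms in eta^0, eta and eta^2 separately.  The first inequality is
    the invertibility of P: its symmetric part is at least the identity. *)
Lemma sqnorm_Amx_Pmx (xL xR T alpha kmin kmax : R) (d : R -> R) N M :
  xL < xR -> 0 < T -> 1 < alpha < 2 -> 0 < kmin ->
  (forall x : R, xL < x < xR -> kmin <= d x <= kmax) ->
  0 < kmax - nu alpha kmin kmax ->
  concave_function `]xL, xR[ d ->
  (1 <= N)%N -> (1 <= M)%N -> forall y : 'cV[R]_M,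
  [/\ sqnorm y <= sqnorm (Pmx xL xR T alpha d N M *m y),
      s_check alpha kmin kmax * sqnorm (Pmx xL xR T alpha d N M *m y) <=
      sqnorm (Amx xL xR T alpha d N M *m y) &
      sqnorm (Amx xL xR T alpha d N M *m y) <=
      s_hat alpha kmin kmax * sqnorm (Pmx xL xR T alpha d N M *m y)].
Proof.
move=> hx hT a12 kmin0 hd hnu dconc N1 M1 y.
have grid_in j : (j < M)%N -> xL < gridpoint xL xR M j.+1 < xR.
  move=> jM; rewrite /gridpoint /meshsize.
  have M0 : 0 < M.+1%:R :> R by [].
  have dx : 0 < xR - xL by rewrite subr_gt0.
  rewrite ltrDl mulr_gt0 ?divr_gt0//= -ltrBrDl mulrCA gtr_pMr//.
  by rewrite ltr_pdivrMr// mul1r ltr_nat.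
have dk j (jM : (j < M)%N) := hd _ (grid_in j jM).
have k12 : kmin <= kmax by have /andP[h1 h2] := dk _ M1; exact: le_trans h2.
have kmax0 : 0 < kmax by exact: lt_le_trans k12.
set h := meshsize xL xR M; set c := Defs.eta xL xR T alpha N M.
have h0 : 0 < h by rewrite divr_gt0// subr_gt0.
have c0 : 0 < c.
  by rewrite divr_gt0// ?divr_gt0 ?ltr0n// mulr_gt0// powR_gt0.
set G := Gmx alpha M.
set db := dbar xL xR d M.
have /andP[db1 db2] : kmin <= db <= kmax.
  have M0 : 0 < M%:R :> R by rewrite ltr0n.
  rewrite /db /dbar big_add1/= big_mkord.
  rewrite ler_pdivlMl// ler_pdivrMl//.
  have cst (k : R) : M%:R * k = \sum_(i < M) k by rewrite sumr_const card_ord mulr_natl.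
  by rewrite !cst; apply/andP; split; apply: ler_sum => i _;
     have /andP[] := dk _ (ltn_ord i).
pose dj j := d (gridpoint xL xR M j.+1).
pose e j := kmax - dj j.
have mult := @convex_multiplier_form R alpha M e (kmax - kmin) y a12.
have {mult} : `|bform G (\col_i (e i * y i 0)) y| <= nu alpha kmin kmax * - bform G y y.
  apply: mult; first by rewrite subr_ge0.
  - move=> j /dk /andP[h1 h2]; rewrite /e /dj subr_ge0 h2/=.
    by rewrite lerD2l lerN2.
  - move=> j k kj jkM.
    have jk : (j - k < M)%N by exact: leq_ltn_trans (leq_subr _ _) (leq_ltn_trans (leq_addr _ _) jkM).
    have := concave_midpoint dconc (grid_in _ jk) (grid_in _ jkM).
    rewrite -/(dj _) -/(dj _).
    have -> : (gridpoint xL xR M (j - k).+1 + gridpoint xL xR M (j + k).+1) / 2 =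
       gridpoint xL xR M j.+1.
      rewrite /gridpoint -(natr1 (j - k)) -(natr1 (j + k)) -(natr1 j) natrB//.
      by rewrite natrD; field.
    by rewrite -/(dj _) /e; lra.
set E := bform G (\col_i (e i * y i 0)) y => E_le.
have H0 : 0 <= - bform G y y by rewrite oppr_ge0 bform_Gmx_le0.
have AE : Amx xL xR T alpha d N M = 1%:M - c *: (diag_mx (\row_i dj i) *m G).
  by [].
have PE : Pmx xL xR T alpha d N M = 1%:M - c *: (diag_mx (\row_(i < M) db) *m G).
  rewrite /Pmx -/c -/db -scalerA -/G; congr (_ - _ *: _).
  by rewrite -mul_scalar_mx; congr (_ *m _); apply/matrixP => i j; rewrite !mxE.
rewrite AE PE !sqnorm_step.
have -> : bform G (\col_i (dj i * y i 0)) y = kmax * bform G y y - E.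
  rewrite /E !bformE mulr_sumr -sumrB; apply: eq_bigr => i _.
  by rewrite !mxE /e; ring.
have -> : bform G (\col_i (db * y i 0)) y = db * bform G y y.
  by rewrite -bformZl; congr (bform _ _ _); apply/colP => i; rewrite !mxE.
rewrite -mulr_sumr -/(sqnorm (G *m y)).
set q := \sum_i _.
have q1 : kmin ^+ 2 * sqnorm (G *m y) <= q.
  rewrite mulr_sumr; apply: ler_sum => i _; rewrite ler_wpM2r ?sqr_ge0//.
  have /andP[h1 h2] := dk _ (ltn_ord i).
  by rewrite ler_sqr ?nnegrE// ?(ltW kmin0)// ?(ltW kmax0)// (le_trans (ltW kmin0)).
have q2 : q <= kmax ^+ 2 * sqnorm (G *m y).
  rewrite mulr_sumr; apply: ler_sum => i _; rewrite ler_wpM2r ?sqr_ge0//.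
  have /andP[h1 h2] := dk _ (ltn_ord i).
  by rewrite ler_sqr ?nnegrE// ?(ltW kmin0)// ?(ltW kmax0)// (le_trans (ltW kmin0)).
have s0 := sqnorm_ge0 y; have g0 := sqnorm_ge0 (G *m y).
have nu0 : 0 <= nu alpha kmin kmax.
  apply: divr_ge0; last exact: normr_ge0.
  by rewrite mulr_ge0 ?sqrtr_ge0 ?subr_ge0.
have E1 : - E <= nu alpha kmin kmax * - bform G y y.
  by apply: le_trans E_le; rewrite lerNl; move: (ler_norm (- E)); rewrite normrN; lra.
have E2 : E <= nu alpha kmin kmax * - bform G y y.
  by apply: le_trans E_le; exact: ler_norm.
clear E_le.
have [m0 m1 m2 m3] := s_check_bounds kmin0 (introT andP (conj db1 db2)) nu0 hnu.
have [t1 t2 t3] := s_hat_bounds kmin0 (introT andP (conj db1 db2)) nu0.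
have db0 : 0 < db by exact: lt_le_trans db1.
move: (s_check _ _ _) (s_hat _ _ _) m0 m1 m2 m3 t1 t2 t3.
move: (nu _ _ _) (bform G y y) (sqnorm y) (sqnorm (G *m y)) E q E1 E2 H0 q1 q2 s0 g0 nu0 hnu
  => v b s g E q E1 E2 b0 q1 q2 s0 g0 v0 vk m t m0 m1 m2 m3 t1 t2 t3.
have c2 : 0 < c ^+ 2 by rewrite exprn_gt0.
split.
- have : 0 <= c * (db * - b) by rewrite mulr_ge0 ?(ltW c0)// mulr_ge0// ltW.
  have : 0 <= c ^+ 2 * (db ^+ 2 * g) by rewrite mulr_ge0 ?sqr_ge0// mulr_ge0 ?sqr_ge0.
  lra.
- have f1 : m * s <= s by nra.
  have f2 : c * (m * db * - b) <= c * (- (kmax * b - E)).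
    by rewrite ler_pM2l//; nra.
  have f3 : c ^+ 2 * (m * db ^+ 2 * g) <= c ^+ 2 * q.
    by rewrite ler_pM2l//; apply: le_trans q1; rewrite ler_wpM2r.
  lra.
- have f1 : s <= t * s by nra.
  have f2 : c * (- (kmax * b - E)) <= c * (t * db * - b).
    by rewrite ler_pM2l//; nra.
  have f3 : c ^+ 2 * q <= c ^+ 2 * (t * db ^+ 2 * g).
    by rewrite ler_pM2l//; apply: (le_trans q2); rewrite ler_wpM2r.
  lra.
Qed.


End Comparison.

Theorem theorem2p4 (R : realType) (xL xR T alpha kmin kmax : R) (d : R -> R)
  (hx : xL < xR) (hT : 0 < T) (halpha : 1 < alpha < 2)
  (hkmin : 0 < kmin) (hkmax : 0 < kmax)
  (hd : forall x : R, xL < x < xR -> kmin <= d x <= kmax)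
  (hnu : 0 < kmax - nu alpha kmin kmax)
  (hconc : concave_function `]xL, xR[ d) :
  let shat := s_hat alpha kmin kmax in
  let scheck := s_check alpha kmin kmax in
  let A := Amx xL xR T alpha d in
  let P := Pmx xL xR T alpha d in
  [/\ 0 < scheck, 0 < shat,
      (forall N M : nat, (1 <= N)%N -> (1 <= M)%N ->
         P N M \in unitmx /\
         sq_singular_values (A N M *m invmx (P N M)) `<=` `[scheck, shat])
    & (ereal_sup [set (cond2 (A NM.1 NM.2 *m invmx (P NM.1 NM.2)))%:E
                 | NM in [set NM : nat * nat | (1 <= NM.1)%N /\ (1 <= NM.2)%N]]
       <= (Num.sqrt (shat / scheck))%:E)%E].
Proof.
move=> shat scheck A P.
have /andP[kmin_le k_le] : kmin <= d ((xL + xR) / 2) <= kmax.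
  by apply: hd; apply/andP; split; lra.
have k12 : kmin <= kmax <= kmax by rewrite lexx (le_trans kmin_le).
have nu0 : 0 <= nu alpha kmin kmax.
  apply: divr_ge0; last exact: normr_ge0.
  by rewrite mulr_ge0 ?sqrtr_ge0 ?subr_ge0//; case/andP: k12.
have [scheck0 _ _ _] := s_check_bounds hkmin k12 nu0 hnu.
have [shat1 _ _] := s_hat_bounds hkmin k12 nu0.
have sand N M (N1 : (1 <= N)%N) (M1 : (1 <= M)%N) :=
  sqnorm_Amx_Pmx hx hT halpha hkmin hd hnu hconc N1 M1.
have Punit N M : (1 <= N)%N -> (1 <= M)%N -> P N M \in unitmx.
  move=> N1 M1; apply: (@sqnorm_inj_unitmx _ _ _ 1) => // y.
  by rewrite mul1r; have [] := sand N M N1 M1 y.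
have lo N M : (1 <= N)%N -> (1 <= M)%N -> forall x : 'cV[R]_M,
    scheck * sqnorm x <= sqnorm (A N M *m invmx (P N M) *m x).
  move=> N1 M1 x; have [_ + _] := sand N M N1 M1 (invmx (P N M) *m x).
  by rewrite -!mulmxA mulKVmx// Punit.
have hi N M : (1 <= N)%N -> (1 <= M)%N -> forall x : 'cV[R]_M,
    sqnorm (A N M *m invmx (P N M) *m x) <= shat * sqnorm x.
  move=> N1 M1 x; have [_ _] := sand N M N1 M1 (invmx (P N M) *m x).
  by rewrite -!mulmxA mulKVmx// Punit.
split => //; first exact: lt_le_trans shat1.
- move=> N M N1 M1; split; first exact: Punit.
  exact: (sq_singular_values_sandwich (lo _ _ N1 M1) (hi _ _ N1 M1)).
- apply: ge_ereal_sup => _ [[N M] /= [N1 M1] <-]; rewrite lee_fin.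
  exact: (cond2_sandwich scheck0 (lo _ _ N1 M1) (hi _ _ N1 M1)).
Qed.
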